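(* For $N\ge2$ shock markers, the invariant distribution of the distances $r_i:=x_{i+1}-x_i$, $1\le i\le N-1$, between consecutive particles of the shock exclusion process is a product distribution with geometric marginals $$\operatorname{Prob}(r_i=k)=\frac{(\rho_N-\rho_i)(\rho_i-\rho_0)}{\rho_i(1-\rho_i)}\left(1-\frac{(\rho_N-\rho_i)(\rho_i-\rho_0)}{\rho_i(1-\rho_i)}\right)^{k-1},\qquad k\ge1.$$
   Context: Fix reals $w>0$, $q>1$, $\lambda\in\mathbb R$, and let $\rho_j=\dfrac{q^{2j-N+\lambda}}{1+q^{2j-N+\lambda}}$ for $0\le j\le N$. In the shock exclusion process, $N$ particles occupy positions $x_1<\dots<x_N$ in $\mathbb Z$ and, independently for each $1\le i\le N$, particle $i$ jumps $x_i\to x_i\pm1$ at rate $w\,v_i^{\pm1}(1-\delta_{x_{i\pm1},x_i\pm1})$ (with $x_0=-\infty$, $x_{N+1}=+\infty$), where $$v_i=\frac{(q-q^{-1})\rho_i(1-\rho_i)}{\rho_i-\rho_{i-1}},\qquad v_i^{-1}=\frac{(q-q^{-1})\rho_{i-1}(1-\rho_{i-1})}{\rho_i-\rho_{i-1}}.$$ (Particles also carry colours, which neighbouring particles at adjacent sites may exchange; this affects neither the positions nor the jump rates.) The distances $(r_1,\dots,r_{N-1})$ form a Markov chain on $\{1,2,\dots\}^{N-1}$; the invariant distribution refers to this chain. *)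

(* Defs.v *)
From HB Require Import structures.
From mathcomp Require Import all_boot all_order all_algebra.
From mathcomp Require Import all_classical all_reals all_analysis.
From mathcomp Require Import ring lra.

Set Implicit Arguments.
Unset Strict Implicit.
Unset Printing Implicit Defensive.

Import Order.TTheory GRing.Theory Num.Theory.
Import numFieldNormedType.Exports.

Local Open Scope classical_set_scope.
Local Open Scope ring_scope.

Definition rho (R : realType) (N : nat) (q lambda : R) (j : nat) : R :=
  let z := q `^ (2 * j%:R - N%:R + lambda) in z / (1 + z).

(* w * vright i and w * vleft i are the rates of the jumps of particle i to the
   right and to the left (1 <= i <= N).  The two formulas are reciprocal to each
   other because rho_i / (1 - rho_i) = q^2 * rho_(i-1) / (1 - rho_(i-1)). *)
Definition vright (R : realType) (N : nat) (q lambda : R) (i : nat) : R :=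
  let rh := rho N q lambda in
  (q - q^-1) * (rh i * (1 - rh i)) / (rh i - rh i.-1).

Definition vleft (R : realType) (N : nat) (q lambda : R) (i : nat) : R :=
  let rh := rho N q lambda in
  (q - q^-1) * (rh i.-1 * (1 - rh i.-1)) / (rh i - rh i.-1).

(* Particle number i (1 <= i <= N) is represented by the ordinal of value
   i - 1, and distance number i (1 <= i <= N - 1) by the ordinal of value
   i - 1 in 'I_N.-1. *)
Definition positions (N : nat) := {ffun 'I_N -> int}.
Definition distances (N : nat) := {ffun 'I_N.-1 -> int}.

(* The conventions x_0 = -oo and x_(N+1) = +oo amount to imposing no
   condition when the neighbour j does not exist. *)
Definition free_right (N : nat) (x : positions N) (i : 'I_N) : bool :=
  [forall j : 'I_N, (j == i.+1 :> nat) ==> (x j != x i + 1)].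

Definition free_left (N : nat) (x : positions N) (i : 'I_N) : bool :=
  [forall j : 'I_N, (j.+1 == i :> nat) ==> (x j != x i - 1)].

Definition jump (N : nat) (x : positions N) (i : 'I_N) (e : int) : positions N :=
  [ffun j => if j == i then x j + e else x j].

(* Markov generator of the positions of the shock exclusion process, acting
   on functions. *)
Definition shock_gen (R : realType) (N : nat) (w q lambda : R)
    (f : positions N -> R) (x : positions N) : R :=
  \sum_(i < N)
    (w * vright N q lambda i.+1 * (free_right x i)%:R * (f (jump x i 1) - f x)
   + w * vleft N q lambda i.+1 * (free_left x i)%:R * (f (jump x i (-1)) - f x)).

Lemma left_end_subproof (N : nat) (i : 'I_N.-1) : (i < N)%N.
Proof. exact: leq_trans (ltn_ord i) (leq_pred N). Qed.

Lemma right_end_subproof (N : nat) (i : 'I_N.-1) : (i.+1 < N)%N.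
Proof. by rewrite -ltn_predRL. Qed.

Definition left_end (N : nat) (i : 'I_N.-1) : 'I_N :=
  Ordinal (left_end_subproof i).
Definition right_end (N : nat) (i : 'I_N.-1) : 'I_N :=
  Ordinal (right_end_subproof i).

Definition dist (N : nat) (x : positions N) : distances N :=
  [ffun i => x (right_end i) - x (left_end i)].

Definition dist_states (N : nat) : set (distances N) :=
  [set r | forall i, 1 <= r i].

(* The configuration with distances r whose first particle is at 0. *)
Definition config (N : nat) (r : distances N) : positions N :=
  [ffun j : 'I_N => \sum_(i < N.-1 | (i < j)%N) r i].

(* Generator of the Markov chain of the distances: the image of shock_gen
   under dist.  By shock_gen_dist below it does not depend on the choice of
   the configuration representing r. *)
Definition dist_gen (R : realType) (N : nat) (w q lambda : R)
    (f : distances N -> R) (r : distances N) : R :=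
  shock_gen w q lambda (f \o @dist N) (config r).

(* exp(t L) f = \sum_n t^n / n! L^n f, the transition semigroup of the
   continuous-time Markov chain with generator L.  The series converges
   pointwise for bounded f here, since all jump rates are bounded. *)
Definition semigroup (R : realType) (S : Type) (L : (S -> R) -> (S -> R))
    (t : R) (f : S -> R) (x : S) : R :=
  limn (series (fun n : nat => t ^+ n / n`!%:R * iter n L f x)).

(* Probability that the chain of the distances is in s at time t, when
   started from r. *)
Definition dist_trans (R : realType) (N : nat) (w q lambda t : R)
    (r s : distances N) : R :=
  semigroup (dist_gen w q lambda) t (fun r' => (r' == s)%:R) r.

(* mu is the probability mass function of a distribution on dist_states. *)
Definition is_distribution (R : realType) (N : nat) (mu : distances N -> R) : Prop :=
  [/\ forall r, 0 <= mu r,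
      forall r, ~ dist_states r -> mu r = 0
    & \esum_(r in @dist_states N) (mu r)%:E = 1%E].

Definition is_invariant (R : realType) (N : nat) (w q lambda : R)
    (mu : distances N -> R) : Prop :=
  is_distribution mu /\
  forall (t : R) (s : distances N), 0 <= t -> dist_states s ->
    \esum_(r in @dist_states N) (mu r * dist_trans w q lambda t r s)%:E
    = (mu s)%:E.

(* Prob(r_i = k) under mu *)
Definition marginal (R : realType) (N : nat) (mu : distances N -> R)
    (i : 'I_N.-1) (k : int) : R :=
  fine (\esum_(r in [set r | @dist_states N r /\ r i = k]) (mu r)%:E).

Definition is_product (R : realType) (N : nat) (mu : distances N -> R) : Prop :=
  forall r, dist_states r -> mu r = \prod_(i < N.-1) marginal mu i (r i).

Definition geom_param (R : realType) (N : nat) (q lambda : R) (i : nat) : R :=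
  let rh := rho N q lambda in
  (rh N - rh i) * (rh i - rh 0) / (rh i * (1 - rh i)).

Lemma dist_config (N : nat) (r : distances N) : dist (config r) = r.
Proof.
apply/ffunP => i; rewrite !ffunE /=.
rewrite (bigD1 i)//= -addrA; set S := (X in _ + (X - _)).
suff -> : S = \sum_(k < N.-1 | (k < i)%N) r k by rewrite subrr addr0.
by apply: eq_bigl => k; rewrite ltnS [in RHS]ltn_neqAle andbC.
Qed.

Lemma config_dist (N : nat) (x : positions N) (j0 j : 'I_N) :
  (j0 = 0 :> nat)%N -> x j = x j0 + config (dist x) j.
Proof.
move=> j00; case: j => j; elim: j => [|j IH] jN.
  rewrite ffunE big1// addr0; congr (x _); exact/val_inj.
have jN' : (j < N.-1)%N by rewrite ltn_predRL.
have := congr1 (fun r : distances N => r (Ordinal jN')) (dist_config (dist x)).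
rewrite ![dist _ _]ffunE.
have -> : right_end (Ordinal jN') = Ordinal jN by exact/val_inj.
have -> : left_end (Ordinal jN') = Ordinal (ltnW jN) by exact/val_inj.
rewrite (IH (ltnW jN)) => /eqP.
by rewrite subr_eq => /eqP ->; ring.
Qed.

Lemma shock_gen_dist (R : realType) (N : nat) (w q lambda : R)
    (f : distances N -> R) (x : positions N) :
  shock_gen w q lambda (f \o @dist N) x = dist_gen w q lambda f (dist x).
Proof.
case: N f x => [|N] f x; first by rewrite /dist_gen /shock_gen !big_ord0.
have xE j : x j = x ord0 + config (dist x) j by exact: config_dist.
rewrite /dist_gen /shock_gen; apply: eq_bigr => i _.
have -> : free_right x i = free_right (config (dist x)) i.
  apply: eq_forallb => j.
  by rewrite (xE j) (xE i) -addrA (inj_eq (addrI _)).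
have -> : free_left x i = free_left (config (dist x)) i.
  apply: eq_forallb => j.
  by rewrite (xE j) (xE i) -addrA (inj_eq (addrI _)).
have jE e : dist (jump x i e) = dist (jump (config (dist x)) i e).
  apply/ffunP => k; rewrite !ffunE.
  rewrite (xE (right_end k)) (xE (left_end k)) /config !ffunE.
  by case: ifP => _; case: ifP => _; ring.
by rewrite /= !jE dist_config.
Qed.

(* The distances form a Markov chain with transition probabilities
   dist_trans. *)
Lemma semigroup_dist (R : realType) (N : nat) (w q lambda t : R)
    (x : positions N) (s : distances N) :
  semigroup (shock_gen w q lambda) t (fun y => (dist y == s)%:R) x
  = dist_trans w q lambda t (dist x) s.
Proof.
rewrite /dist_trans /semigroup; congr (limn (series _)); apply/funext => n.
congr (_ * _); elim: n x => [//|n IH] x.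
by rewrite !iterS -shock_gen_dist; congr (shock_gen _ _ _ _ x); apply/funext.
Qed.

(* Main.v *)
(* In the variables r_i the chain is a zero-range process with constant rates on
   the sites 1, ..., N - 1 between two reservoirs 0 and N.  Its stationarity
   reduces to the traffic equation: with z_i = 1 - p_i the flux
   v_i z_i - v_i^-1 z_(i-1) = (q - q^-1) (1 - rho_N - rho_0) is the same for all
   i, and z_0 = z_N = 1, so the net flow into each state telescopes to 0.

   To pass from the generator L to the semigroup, write L = Lam (K - I) with a
   stochastic operator K; then exp(t L) is the mixture of the powers K^n with
   Poisson weights, hence positive, mass-nonincreasing, and it preserves every
   measure preserved by K.

   Uniqueness: for invariant mu, nu the excess mu - min (mu, nu) is invariant,
   and by irreducibility it vanishes identically or nowhere; in both cases mu
   and nu are comparable, and having the same mass they agree. *)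
Require Import Defs.
From HB Require Import structures.
From mathcomp Require Import all_boot all_order all_algebra.
From mathcomp Require Import all_classical all_reals all_analysis.
From mathcomp Require Import ring zify.

Set Implicit Arguments.
Unset Strict Implicit.
Unset Printing Implicit Defensive.

Import Order.TTheory GRing.Theory Num.Theory.
Import numFieldNormedType.Exports.

Local Open Scope classical_set_scope.
Local Open Scope ring_scope.

(** * Products of exponential series *)

(** Each pair [(i, j)] below the diagonal [i + j < M] occurs once, for [n = i + j]. Spreading the
    triangle over the full square lets it be subtracted term by term from a product of partial
    sums. *)
Lemma series_convolution (R : pzRingType) (a b : nat -> R) (M : nat) :
  \sum_(n < M) \sum_(i < n.+1) a i * b (n - i)%N =
  \sum_(i < M) \sum_(j < M) a i * b j *+ (i + j < M)%N.
Proof.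
under eq_bigr => n _.
  have -> : \sum_(i < n.+1) a i * b (n - i)%N =
            \sum_(i < M) \sum_(j < M) a i * b j *+ (i + j == n)%N.
    rewrite (big_ord_widen_cond M xpredT (fun i => a i * b (n - i)%N))//.
    rewrite big_mkcond/=; apply: eq_bigr => i _; case: ltnP => [in1|ni].
      have jM : (n - i < M)%N by rewrite (leq_ltn_trans (leq_subr _ _)).
      rewrite (bigD1 (Ordinal jM))//= subnKC// eqxx mulr1n big1 ?addr0// => j jn.
      case: eqP => // ijn; case/eqP: jn; apply/val_inj => /=.
      by rewrite -ijn addKn.
    rewrite big1// => j _; case: eqP => // ijn.
    by move: ni; rewrite -ijn ltnNge leq_addr.
  over.
rewrite exchange_big; apply: eq_bigr => i _; rewrite exchange_big.
apply: eq_bigr => j _ /=; rewrite sumrMnr; case: ltnP => ijM.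
  rewrite (bigD1 (Ordinal ijM))//= eqxx big1 ?addn0// => n nij.
  by case: eqP => // ijn; case/eqP: nij; apply/val_inj.
by rewrite big1// => n _; case: eqP => // ijn; move: ijM; rewrite ijn leqNgt ltn_ord.
Qed.

Lemma exp_coeffD (R : realType) (x y : R) (n : nat) :
  exp_coeff (x + y) n = \sum_(i < n.+1) exp_coeff x i * exp_coeff y (n - i)%N.
Proof.
rewrite /exp_coeff /= addrC exprDn mulr_suml; apply: eq_bigr => i _.
have iln : (i <= n)%N by rewrite -ltnS.
have fN0 k : k`!%:R != 0 :> R by rewrite pnatr_eq0 -lt0n fact_gt0.
rewrite -(mulr_natr _ 'C(n, i)) -(bin_fact iln) !natrM.
have : 'C(n, i)%:R != 0 :> R by rewrite pnatr_eq0 -lt0n bin_gt0.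
by move=> ?; field; rewrite !fN0.
Qed.

(* The terms with [i, j < M <= i + j] of the product of the partial sums are
   dominated by those of two positive exponential series, whose sum tends to
   [expR x ^+ 2 - expR (x + x) = 0]. *)
Lemma cvg_exp_convolution (R : realType) (x : R) (a : nat -> R) :
  0 <= x -> (forall n, `|a n| <= 1) ->
  series (fun n => \sum_(i < n.+1)
    exp_coeff (- x) i * (exp_coeff x (n - i)%N * a (n - i)%N)) @ \oo -->
  expR (- x) * limn (series (fun n => exp_coeff x n * a n)).
Proof.
move=> x0 a1; set c := fun n => _; set b := fun n => exp_coeff x n * a n.
have leb n : `|b n| <= exp_coeff x n.
  by rewrite normrM (ger0_norm (exp_coeff_ge0 _ _))// ler_piMr// exp_coeff_ge0.
have cb : cvgn (series b).
  apply: normed_cvg; apply: series_le_cvg (is_cvg_series_exp_coeff x) => n //=.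
  exact: exp_coeff_ge0.
have SM (u : nat -> R) M : series u M = \sum_(i < M) u i.
  by rewrite /series /= big_mkord.
have AB : series (exp_coeff (- x)) \* series b @ \oo -->
    expR (- x) * limn (series b).
  by apply: cvgM => //; exact: is_cvg_series_exp_coeff.
have E : (fun M => series (exp_coeff x) M ^+ 2 - series (exp_coeff (x + x)) M)
    @ \oo --> (0 : R).
  have -> : 0 = expR x ^+ 2 - expR (x + x) by rewrite expRD expr2 subrr.
  apply: cvgB; last exact: is_cvg_series_exp_coeff.
  by under eq_fun do rewrite expr2; apply: cvgM; exact: is_cvg_series_exp_coeff.
have tail (u v : nat -> R) M : series u M * series v M -
    series (fun n => \sum_(i < n.+1) u i * v (n - i)%N) M =
    \sum_(i < M) \sum_(j < M) u i * v j *+ (M <= i + j)%N.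
  rewrite !SM series_convolution mulr_suml -sumrB; apply: eq_bigr => i _.
  rewrite mulr_sumr -sumrB; apply: eq_bigr => j _.
  by case: leqP => _; rewrite ?subr0 ?subrr.
have F : (fun M => (series (exp_coeff (- x)) M * series b M) - series c M)
    @ \oo --> (0 : R).
  apply/norm_cvg0P; apply: (squeeze_cvgr _ (cvg_cst 0) E); near=> M.
  rewrite normr_ge0/= /c tail expr2.
  have -> : series (exp_coeff (x + x)) M =
      series (fun n => \sum_(i < n.+1) exp_coeff x i * exp_coeff x (n - i)%N) M.
    by rewrite !SM; apply: eq_bigr => n _; rewrite exp_coeffD.
  rewrite tail; apply: le_trans (ler_norm_sum _ _ _) _; apply: ler_sum => i _.
  apply: le_trans (ler_norm_sum _ _ _) _; apply: ler_sum => j _.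
  rewrite normrMn ler_wMn2r// normrM ler_pM//.
  by rewrite /exp_coeff /= normrM normrX normrN (ger0_norm x0) ger0_norm ?invr_ge0.
have -> : expR (- x) * limn (series b) = expR (- x) * limn (series b) - 0.
  by rewrite subr0.
have -> : series c = (fun M => (series (exp_coeff (- x)) M * series b M) -
   (series (exp_coeff (- x)) M * series b M - series c M)).
  by apply/funext => M; rewrite opprB addrC subrK.
exact: cvgB.
Unshelve. all: by end_near.
Qed.

(** * Sums of nonnegative families *)

Section Esum.
Context (R : realType).
Local Open Scope ereal_scope.

Lemma exchange_esum (T1 T2 : choiceType) (I : set T1) (J : set T2)
    (a : T1 -> T2 -> \bar R) :
  (forall i j, I i -> J j -> 0 <= a i j) ->
  \esum_(i in I) \esum_(j in J) a i j = \esum_(j in J) \esum_(i in I) a i j.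
Proof.
move=> a0; rewrite !esum_esum//; last by move=> i j Ji Ij; exact: a0.
rewrite (@reindex_esum R _ _ (J `*`` (fun=> I)) _ (fun k => (k.2, k.1)))//.
split=> [[i j] [//]|[i j] [i' j'] _ _ [-> ->]//|[i j] [Ii Jj]].
by exists (j, i).
Qed.

Lemma esumZl (T : choiceType) (I : set T) (c : R) (a : T -> \bar R) :
  (0 <= c)%R -> (forall i, I i -> 0 <= a i) ->
  \esum_(i in I) (c%:E * a i) = c%:E * \esum_(i in I) a i.
Proof.
(* One inequality is enough: the converse is [half] for the constant [c^-1] and the family
   [c%:E * a i], once [c = 0] has been set aside. *)
have half (k : R) (b : T -> \bar R) : (0 <= k)%R -> (forall i, I i -> 0 <= b i) ->
    \esum_(i in I) (k%:E * b i) <= k%:E * \esum_(i in I) b i.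
  move=> k0 b0; apply: ge_ereal_sup => _ [X [finX XI] <-].
  rewrite !fsbig_finite//= big_seq_cond -ge0_sume_distrr; last first.
    move=> i; rewrite andbT in_fset_set// inE => /XI; exact: b0.
  rewrite -big_seq_cond lee_wpmul2l ?lee_fin//.
  by apply: ereal_sup_ubound; exists X => //; rewrite fsbig_finite.
rewrite le_eqVlt => /predU1P[<- a0|c0 a0].
  by rewrite mul0e esum1// => i _; rewrite mul0e.
apply/eqP; rewrite eq_le half ?(ltW c0)//=.
have ca0 i : I i -> 0 <= c%:E * a i.
  by move=> /a0 ?; rewrite mule_ge0// lee_fin ltW.
rewrite -[leRHS]mul1e -[1](_ : c%:E * c^-1%:E = _); last first.
  by rewrite -EFinM divff// gt_eqF.
rewrite -muleA lee_pmul2l ?fin_numE//.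
rewrite (eq_esum (b := fun i => c^-1%:E * (c%:E * a i))).
  by apply: half => //; rewrite invr_ge0 ltW.
by move=> i _; rewrite muleA -EFinM mulVf ?mul1e// gt_eqF.
Qed.

Lemma le_term_esum (T : choiceType) (I : set T) (a : T -> \bar R) (x : T) :
  (forall i, I i -> 0 <= a i) -> I x -> a x <= \esum_(i in I) a i.
Proof.
move=> a0 Ix; apply: esum_ge; exists [set x].
  by split=> // _ ->.
by rewrite fsbig_set1.
Qed.

(** The differences [b i - a i] are nonnegative, and finiteness of the sum of [a] allows it to be
    cancelled, so that they sum to at most 0. *)
Lemma esum_le_eq (T : choiceType) (I : set T) (a b : T -> R) :
  (forall i, I i -> (0 <= a i <= b i)%R) ->
  \esum_(i in I) (b i)%:E <= \esum_(i in I) (a i)%:E ->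
  \esum_(i in I) (a i)%:E < +oo ->
  forall i, I i -> a i = b i.
Proof.
move=> ab ba afin i Ii.
have a0 j : I j -> 0 <= (a j)%:E by move=> /ab /andP[]; rewrite lee_fin.
have d0 j : I j -> 0 <= (b j - a j)%:E.
  by move=> /ab /andP[_]; rewrite lee_fin subr_ge0.
have D : \esum_(i in I) (b i)%:E =
    \esum_(i in I) (a i)%:E + \esum_(i in I) (b i - a i)%:E.
  by rewrite -esumD//; apply: eq_esum => j _; rewrite -EFinD addrC subrK.
have afn : \esum_(i in I) (a i)%:E \is a fin_num by rewrite ge0_fin_numE// esum_ge0.
have := ba; rewrite D -[leRHS]adde0 leeD2lE// => d_le0.
have := le_trans (le_term_esum d0 Ii) d_le0.
rewrite lee_fin subr_le0 => ba'; apply/eqP; rewrite eq_le ba'.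
by have /andP[_ ->] := ab _ Ii.
Qed.

End Esum.

Lemma eseries_EFinZ (R : realType) (c : R) (u : nat -> R) : cvgn (series u) ->
  (\sum_(n <oo) (c * u n)%:E = (c * limn (series u))%:E)%E.
Proof.
move=> cu.
have -> : (fun n => \sum_(0 <= i < n) (c * u i)%:E)%E =
    EFin \o (fun n => c * series u n).
  by apply/funext => n /=; rewrite sumEFin mulr_sumr.
by apply: cvg_lim => //; apply: cvg_EFin; [exact: nearW|exact: cvgMl_tmp].
Qed.

(** * Jump processes with bounded rates *)

Section Poisson.
Context (R : realType).

Definition poisson (x : R) (n : nat) : R := expR (- x) * exp_coeff x n.

Lemma poisson_ge0 x n : 0 <= x -> 0 <= poisson x n.
Proof. by move=> x0; rewrite mulr_ge0 ?expR_ge0 ?exp_coeff_ge0. Qed.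

Lemma poisson_gt0 x n : 0 < x -> 0 < poisson x n.
Proof.
by move=> x0; rewrite mulr_gt0 ?expR_gt0// divr_gt0 ?exprn_gt0.
Qed.

Lemma sum_poisson x : (\sum_(n <oo) (poisson x n)%:E = 1)%E.
Proof.
transitivity (expR (- x) * expR x)%:E; last by rewrite -expRD addNr expR0.
by rewrite {2}/expR -eseries_EFinZ//; exact: is_cvg_series_exp_coeff.
Qed.

End Poisson.

Section Indicator.
Context (R : realType) (T : choiceType).

Definition indic_eq (s : T) : T -> R := fun x => (x == s)%:R.

Lemma indic_eq01 s x : 0 <= indic_eq s x <= 1.
Proof. by rewrite /indic_eq; case: eqP => _; rewrite ?lexx ?ler01. Qed.

Lemma indic_eq_ge0 s x : 0 <= indic_eq s x.
Proof. by have /andP[] := indic_eq01 s x. Qed.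

Lemma sum_indic_eq_le1 (s : seq T) x :
  uniq s -> \sum_(y <- s) indic_eq y x <= 1.
Proof.
move=> us; have [xs|xs] := boolP (x \in s).
  rewrite (bigD1_seq x)//= big1 ?addr0 => [|y /negbTE yx].
    by have /andP[] := indic_eq01 x x.
  by rewrite /indic_eq eq_sym yx.
rewrite big_seq_cond big1 ?ler01// => y /andP[ys _].
by rewrite /indic_eq; case: eqP => // xy; rewrite xy ys in xs.
Qed.

End Indicator.

Section JumpProcess.
Context (R : realType) (T : choiceType) (E : finType).
Variables (rate : E -> T -> R) (tau : E -> T -> T) (Lam : R).

(** The jumps are sorted into finitely many types [e], each with one target [tau e x] per state, so
    that [tau e] can later be required to be a bijection. *)
Definition jump_gen (f : T -> R) (x : T) : R :=
  \sum_e rate e x * (f (tau e x) - f x).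

(** One step of the uniformized chain, that is [I + L / Lam]. *)
Definition unif_kernel (f : T -> R) (x : T) : R := f x + Lam^-1 * jump_gen f x.

Hypothesis Lam0 : 0 < Lam.
Hypothesis rate_ge0 : forall e x, 0 <= rate e x.
Hypothesis rate_le : forall x, \sum_e rate e x <= Lam.

Local Notation K := unif_kernel.
Local Notation L := jump_gen.

(** In this form [K f x] is a convex combination of values of [f] as soon as [Lam] bounds the total
    rate; positivity and the bound by 1 are read off from it. *)
Lemma unif_kernelE f x :
  K f x = (1 - (\sum_e rate e x) / Lam) * f x +
          \sum_e rate e x / Lam * f (tau e x).
Proof.
rewrite /unif_kernel /jump_gen.
under eq_bigr do rewrite mulrBr.
rewrite sumrB -mulr_suml mulrBr.
have -> : \sum_e rate e x / Lam * f (tau e x) =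
    Lam^-1 * \sum_e rate e x * f (tau e x).
  by rewrite mulr_sumr; apply: eq_bigr => e _; ring.
ring.
Qed.

Lemma stay_ge0 x : 0 <= 1 - (\sum_e rate e x) / Lam.
Proof. by rewrite subr_ge0 ler_pdivrMr// mul1r. Qed.

Lemma unif_kernel_ge0 f : (forall x, 0 <= f x) -> forall x, 0 <= K f x.
Proof.
move=> f0 x; rewrite unif_kernelE addr_ge0 ?mulr_ge0 ?stay_ge0//.
by apply: sumr_ge0 => e _; rewrite mulr_ge0// divr_ge0// ltW.
Qed.

Lemma unif_kernel_le1 f : (forall x, f x <= 1) -> forall x, K f x <= 1.
Proof.
move=> f1 x; rewrite unif_kernelE.
rewrite [leRHS](_ : _ = (1 - (\sum_e rate e x) / Lam) * 1 +
    \sum_e rate e x / Lam * 1); last first.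
  by rewrite -!mulr_suml; ring.
rewrite lerD ?ler_wpM2l ?stay_ge0//; apply: ler_sum => e _.
by rewrite ler_wpM2l// divr_ge0// ltW.
Qed.

Lemma iter_kernel_ge0 f n : (forall x, 0 <= f x) -> forall x, 0 <= iter n K f x.
Proof. by move=> f0; elim: n => //= n IH; exact: unif_kernel_ge0. Qed.

Lemma iter_kernel_le1 f n : (forall x, f x <= 1) -> forall x, iter n K f x <= 1.
Proof. by move=> f1; elim: n => //= n IH; exact: unif_kernel_le1. Qed.

Lemma unif_kernel_lin (a : R) f g :
  K (fun x => a * f x + g x) = (fun x => a * K f x + K g x).
Proof.
apply/funext => x; rewrite !unif_kernelE.
have -> : \sum_e rate e x / Lam * (a * f (tau e x) + g (tau e x)) =
    a * (\sum_e rate e x / Lam * f (tau e x)) +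
    \sum_e rate e x / Lam * g (tau e x).
  by rewrite mulr_sumr -big_split; apply: eq_bigr => e _ /=; ring.
ring.
Qed.

Lemma iter_kernel_lin (a : R) f g n :
  iter n K (fun x => a * f x + g x) = (fun x => a * iter n K f x + iter n K g x).
Proof. by elim: n => //= n ->; rewrite unif_kernel_lin. Qed.

Lemma iter_kernel0 n x : iter n K (fun=> 0) x = 0.
Proof.
elim: n x => //= n IH x.
by rewrite unif_kernelE IH mulr0 add0r big1// => e _; rewrite IH mulr0.
Qed.

Lemma iter_kernel_sum (I : Type) (r : seq I) (f : I -> T -> R) n x :
  iter n K (fun y => \sum_(i <- r) f i y) x = \sum_(i <- r) iter n K (f i) x.
Proof.
elim: r => [|i r IH].
  rewrite big_nil -[RHS](iter_kernel0 n x); congr (iter n K _ x).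
  by apply/funext => y; rewrite big_nil.
rewrite big_cons -IH -[X in X + _]mul1r.
have /(congr1 (@^~ x)) /= <- := iter_kernel_lin 1 (f i)
  (fun y => \sum_(i <- r) f i y) n.
by congr (iter n K _ x); apply/funext => y; rewrite big_cons mul1r.
Qed.

Lemma jump_genE f : L f = fun x => Lam * (K f x - f x).
Proof.
by apply/funext => x; rewrite /unif_kernel addrC addKr mulVKf// gt_eqF.
Qed.

(** This is the binomial theorem for [Lam * (K - I)], where [K] commutes with the identity; the
    induction peels off one [L] next to [f] and uses Pascal's rule. *)
Lemma iter_jump_gen n f x :
  iter n L f x =
  Lam ^+ n * \sum_(i < n.+1) (-1) ^+ i * 'C(n, i)%:R * iter (n - i) K f x.
Proof.
elim: n f => [|n IH] f.
  by rewrite big_ord_recl big_ord0 /= expr0 bin0; ring.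
rewrite iterSr IH exprSr -mulrA; congr (_ * _).
pose a m := iter m K f x.
have KL m : iter m K (L f) x = Lam * (a m.+1 - a m).
  rewrite jump_genE.
  have -> : (fun x => Lam * (K f x - f x)) =
     (fun x => Lam * K f x + (- Lam * f x + (fun=> 0) x)).
    by apply/funext => y; ring.
  by rewrite !iter_kernel_lin iter_kernel0 -iterSr addr0 mulNr mulrBr.
under eq_bigr do rewrite KL.
under [in RHS]eq_bigr do rewrite -/(a _).
clearbody a; rewrite mulr_sumr.
rewrite [RHS]big_ord_recl /= bin0 ?subn0.
under [in RHS]eq_bigr => i _ do rewrite /bump /= add1n binS subSS natrD.
(* The additional last term contains ['C(n, n.+1) = 0]; it gives the first sum the index range of
   the goal. *)
transitivity (\sum_(i < n.+2) Lam * ((-1) ^+ i * 'C(n, i)%:R * a (n.+1 - i)%N)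
   - \sum_(i < n.+1) Lam * ((-1) ^+ i * 'C(n, i)%:R * a (n - i)%N)).
  rewrite [X in _ = X - _]big_ord_recr /= bin_small//.
  rewrite mulr0n mulr0 mul0r mulr0 addr0 -sumrB.
  apply: eq_bigr => i _.
  have iln : (i <= n)%N by rewrite -ltnS.
  by rewrite [in RHS]subSn//; ring.
rewrite big_ord_recl /= bin0 ?subn0 -addrA; congr (_ + _).
rewrite -sumrB; apply: eq_bigr => i _.
by rewrite /bump /= add1n subSS exprS; ring.
Qed.

(** The terms of exp(t L) become those of the Cauchy product of exp(- Lam t) and exp(Lam t K), the
    shape treated by [cvg_exp_convolution]. *)
Lemma expand_jump_gen n t f x :
  t ^+ n / n`!%:R * iter n L f x =
  \sum_(i < n.+1) exp_coeff (- (Lam * t)) i *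
    (exp_coeff (Lam * t) (n - i)%N * iter (n - i) K f x).
Proof.
rewrite iter_jump_gen mulrA mulr_sumr; apply: eq_bigr => i _.
rewrite !mulrA; congr (_ * _); rewrite /exp_coeff /=.
have iln : (i <= n)%N by rewrite -ltnS.
have fN0 k : k`!%:R != 0 :> R by rewrite pnatr_eq0 -lt0n fact_gt0.
rewrite -[X in X^-1](_ : ('C(n, i) * (i`! * (n - i)`!))%:R = _ :> R); last first.
  by rewrite bin_fact.
have : 'C(n, i)%:R != 0 :> R by rewrite pnatr_eq0 -lt0n bin_gt0.
have -> : Lam ^+ n = Lam ^+ i * Lam ^+ (n - i) by rewrite -exprD subnKC.
have -> : t ^+ n = t ^+ i * t ^+ (n - i) by rewrite -exprD subnKC.
rewrite !natrM [(- (Lam * t)) ^+ i]exprNn !exprMn => ?; field; by rewrite !fN0.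
Qed.

(** Since [f] takes values in [0, 1], so do all [iter n K f]; hence the series of exp(Lam t K)
    converges absolutely and the Cauchy product may be factored. *)
Lemma semigroup_series t f x : 0 <= t -> (forall y, 0 <= f y <= 1) ->
  (semigroup L t f x)%:E =
  (\sum_(n <oo) (poisson (Lam * t) n * iter n K f x)%:E)%E.
Proof.
move=> t0 f01.
have Lt0 : 0 <= Lam * t by rewrite mulr_ge0// ltW.
have f0 y : 0 <= f y by have /andP[] := f01 y.
have f1 y : f y <= 1 by have /andP[] := f01 y.
have a1 n : `|iter n K f x| <= 1.
  by rewrite ger0_norm ?iter_kernel_ge0 ?iter_kernel_le1.
have := cvg_exp_convolution Lt0 a1.
set b := fun n => exp_coeff (Lam * t) n * _.
under [in X in X -> _]eq_fun do rewrite -expand_jump_gen.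
rewrite /semigroup => /cvg_lim -> //.
have cb : cvgn (series b).
  apply: normed_cvg.
  apply: series_le_cvg (is_cvg_series_exp_coeff (Lam * t)) => n //=.
    exact: exp_coeff_ge0.
  by rewrite normrM (ger0_norm (exp_coeff_ge0 _ _))// ler_piMr// exp_coeff_ge0.
rewrite -eseries_EFinZ//; congr (limn _); apply/funext => n /=.
by apply: eq_bigr => i _; rewrite /poisson /b mulrA.
Qed.

Local Notation pmf t n := (poisson (Lam * t) n).

Lemma iter_indic_ge0 n s r : 0 <= iter n K (indic_eq R s) r.
Proof. by apply: iter_kernel_ge0 => // ?; exact: indic_eq_ge0. Qed.

(** * Transition probabilities at a fixed time *)

Section Time.
Variable (t : R).
Hypothesis t0 : 0 <= t.

Let Lt0 : 0 <= Lam * t. Proof. by rewrite mulr_ge0// ltW. Qed.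

Let trans (r s : T) : R := semigroup L t (indic_eq R s) r.

Lemma transE r s :
  (trans r s)%:E =
  (\esum_(n in [set: nat]) (pmf t n * iter n K (indic_eq R s) r)%:E)%E.
Proof.
rewrite /trans semigroup_series//; last exact: indic_eq01.
rewrite nneseries_esumT// => n.
by rewrite lee_fin mulr_ge0 ?poisson_ge0// iter_indic_ge0.
Qed.

Lemma term_ge0 r s n : 0 <= pmf t n * iter n K (indic_eq R s) r.
Proof. by rewrite mulr_ge0 ?poisson_ge0// iter_indic_ge0. Qed.

Lemma trans_ge0 r s : 0 <= trans r s.
Proof.
by rewrite -lee_fin transE; apply: esum_ge0 => n _; rewrite lee_fin term_ge0.
Qed.

(** The indicators of finitely many distinct targets add up to at most 1, and [K] is linear and
    preserves this bound. *)
Lemma esum_kernel_le1 (S : set T) n r :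
  (\esum_(s in S) (iter n K (indic_eq R s) r)%:E <= 1)%E.
Proof.
apply: ge_ereal_sup => _ [A [finA AS] <-].
rewrite fsbig_finite//= sumEFin lee_fin.
rewrite -iter_kernel_sum; apply: iter_kernel_le1 => // x.
apply: sum_indic_eq_le1; exact: finmap.fset_uniq.
Qed.

Lemma trans_substoch (S : set T) r : (\esum_(s in S) (trans r s)%:E <= 1)%E.
Proof.
under eq_esum do rewrite transE.
rewrite exchange_esum; last by move=> s n _ _; rewrite lee_fin term_ge0.
rewrite -(sum_poisson (Lam * t)) nneseries_esumT; last first.
  by move=> n; rewrite lee_fin poisson_ge0.
apply: le_esum => n _.
under eq_esum do rewrite EFinM.
rewrite esumZl ?poisson_ge0//; last first.
  move=> s _; rewrite lee_fin; exact: iter_indic_ge0.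
by rewrite -[leRHS]mule1 lee_wpmul2l ?esum_kernel_le1// lee_fin poisson_ge0.
Qed.

(** The term [n = 1] of the Poisson mixture is already positive: it contains the single jump [e]. *)
Lemma trans_gt0 e r : 0 < t -> 0 < rate e r -> 0 < trans r (tau e r).
Proof.
move=> tpos re0; rewrite -lte_fin transE.
apply: lt_le_trans (le_term_esum (x := 1%N) _ _) => //; last first.
  by move=> n _; rewrite lee_fin term_ge0.
rewrite lte_fin mulr_gt0 ?poisson_gt0 ?mulr_gt0//= unif_kernelE.
rewrite ltr_wpDl ?mulr_ge0 ?stay_ge0 ?indic_eq_ge0// (bigD1 e)//=.
rewrite ltr_pwDl//.
  by rewrite mulr_gt0 ?divr_gt0// /indic_eq eqxx ltr01.
by apply: sumr_ge0 => e' _; rewrite mulr_ge0 ?divr_ge0 ?indic_eq_ge0// ltW.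
Qed.

(** * Stationarity from global balance *)

Section Stationary.
Variables (m : T -> R) (taui : E -> T -> T).
Hypothesis m0 : forall r, 0 <= m r.
Hypothesis tauK : forall e, cancel (tau e) (taui e).
Hypothesis tauiK : forall e, cancel (taui e) (tau e).
(** Inflow equals outflow: as [tau e] is a bijection, [taui e r] is the only state from which a jump
    of type [e] leads to [r]. *)
Hypothesis balance : forall r,
  \sum_e m (taui e r) * rate e (taui e r) = m r * \sum_e rate e r.

(** Reindexing the jump terms of type [e] along [taui e] moves [K] from [f] onto [m], where
    [balance] shows that it fixes [m]. *)
Lemma kernel_stationary f : (forall x, 0 <= f x) ->
  (\esum_(r in [set: T]) (m r * K f r)%:E = \esum_(r in [set: T]) (m r * f r)%:E)%E.
Proof.
move=> f0.
under eq_esum => r _.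
  rewrite unif_kernelE mulrDr mulr_sumr EFinD -sumEFin; over.
have ge0 e r : 0 <= m r * (rate e r / Lam * f (tau e r)).
  by rewrite !mulr_ge0 ?invr_ge0// ltW.
have ge0' r : 0 <= m r * ((1 - (\sum_e rate e r) / Lam) * f r).
  by rewrite !mulr_ge0 ?stay_ge0.
rewrite esumD; first last.
- by move=> r _; apply: sume_ge0 => e _; rewrite lee_fin.
- by move=> r _; rewrite lee_fin.
rewrite esum_sum; last by move=> r e _ _; rewrite lee_fin.
under eq_bigr => e _.
  rewrite (@reindex_esum R _ _ setT _ (taui e)); last first.
    split=> [//|x y _ _ xy|x _]; first by rewrite -(tauiK e x) xy tauiK.
    by exists (tau e x) => //; rewrite tauK.
  under eq_esum do rewrite tauiK.
  over.
have ge0i e r : 0 <= m (taui e r) * (rate e (taui e r) / Lam * f r).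
  by rewrite !mulr_ge0 ?invr_ge0// ltW.
rewrite -esum_sum; last by move=> r e _ _; rewrite lee_fin.
rewrite -esumD; first last.
- by move=> r _; apply: sume_ge0 => e _; rewrite lee_fin.
- by move=> r _; rewrite lee_fin.
apply: eq_esum => r _; rewrite sumEFin -EFinD; congr (_%:E).
have -> : \sum_e m (taui e r) * (rate e (taui e r) / Lam * f r) =
   (\sum_e m (taui e r) * rate e (taui e r)) / Lam * f r.
  by rewrite !mulr_suml; apply: eq_bigr => e _; ring.
by rewrite balance; ring.
Qed.

Lemma iter_kernel_stationary f n : (forall x, 0 <= f x) ->
  (\esum_(r in [set: T]) (m r * iter n K f r)%:E =
   \esum_(r in [set: T]) (m r * f r)%:E)%E.
Proof.
move=> f0; elim: n => // n IH; rewrite iterS -IH; apply: kernel_stationary.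
exact: iter_kernel_ge0.
Qed.

Lemma trans_stationary s :
  (\esum_(r in [set: T]) (m r * trans r s)%:E = (m s)%:E)%E.
Proof.
have ind : (\esum_(r in [set: T]) (m r * indic_eq R s r)%:E = (m s)%:E)%E.
  rewrite (esumID [set s]); last first.
    by move=> r _; rewrite lee_fin mulr_ge0 ?indic_eq_ge0.
  rewrite setTI setTI esum_set1; last by rewrite lee_fin mulr_ge0 ?indic_eq_ge0.
  rewrite esum1 ?adde0 /indic_eq ?eqxx ?mulr1// => r /= /eqP/negbTE ->.
  by rewrite mulr0.
under eq_esum => r _.
  rewrite EFinM transE -esumZl//; last first.
    by move=> n _; rewrite lee_fin term_ge0.
  over.
rewrite exchange_esum; last first.
  by move=> r n _ _; rewrite -EFinM lee_fin mulr_ge0 ?term_ge0.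
transitivity (\esum_(n in [set: nat]) ((m s)%:E * (pmf t n)%:E))%E.
  apply: eq_esum => n _.
  rewrite muleC -ind -(iter_kernel_stationary n (indic_eq_ge0 R s)).
  rewrite -esumZl ?poisson_ge0//; last first.
    move=> r _; rewrite lee_fin mulr_ge0 ?iter_indic_ge0//.
  by apply: eq_esum => r _; rewrite -!EFinM; congr (_%:E); ring.
rewrite esumZl//; last by move=> n _; rewrite lee_fin poisson_ge0.
rewrite -nneseries_esumT; last by move=> n; rewrite lee_fin poisson_ge0.
by rewrite sum_poisson mule1.
Qed.

End Stationary.
End Time.
End JumpProcess.

(** * Uniqueness of invariant distributions *)

Section Uniqueness.
Context (R : realType) (T : choiceType) (S : set T) (P : T -> T -> R).
Hypothesis P0 : forall r s, S r -> S s -> 0 <= P r s.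
Hypothesis P1 : forall r, S r -> (\esum_(s in S) (P r s)%:E <= 1)%E.
(** Irreducibility is phrased by closed sets, which avoids paths and powers of [P]; [excess_pos]
    applies it to the set where the excess is positive. *)
Hypothesis irr : forall A : set T,
  (forall r s, S r -> S s -> A r -> 0 < P r s -> A s) ->
  (exists2 r, S r & A r) -> S `<=` A.

Let invariant_mass (m : T -> R) := [/\ forall r, S r -> 0 <= m r,
  (\esum_(r in S) (m r)%:E = 1)%E &
  forall s, S s -> (\esum_(r in S) (m r * P r s)%:E = (m s)%:E)%E].

(* The common part [min m n] is superinvariant, so the excess of [m] over it is
   subinvariant, hence invariant since [P] does not increase the mass. *)
Lemma excess_pos (m n : T -> R) : invariant_mass m -> invariant_mass n ->
  (exists2 r, S r & n r < m r) -> forall r, S r -> n r < m r.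
Proof.
move=> [m0 m1 mP] [n0 n1 nP] ex.
pose h r := Num.min (m r) (n r); pose g r := m r - h r.
have h0 r : S r -> 0 <= h r by move=> Sr; rewrite /h le_min m0 ?n0.
have hm r : h r <= m r by rewrite ge_min lexx.
have hn r : h r <= n r by rewrite ge_min lexx orbT.
have g0 r : 0 <= g r by rewrite subr_ge0.
have g_gt0 r : (0 < g r) = (n r < m r).
  by rewrite subr_gt0 /h; case: (ltP (m r) (n r)) => [/ltW|//];
    rewrite ltxx leNgt => /negbTE ->.
have hP s : S s -> (\esum_(r in S) (h r * P r s)%:E <= (h s)%:E)%E.
  move=> Ss; rewrite {2}/h EFin_min le_min; apply/andP; split.
    rewrite -mP//; apply: le_esum => r Sr.
    by rewrite lee_fin ler_wpM2r// P0.
  rewrite -nP//; apply: le_esum => r Sr.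
  by rewrite lee_fin ler_wpM2r// P0.
pose gP s := (\esum_(r in S) (g r * P r s)%:E)%E.
have gP0 s : S s -> (0 <= gP s)%E.
  by move=> Ss; apply: esum_ge0 => r Sr; rewrite lee_fin mulr_ge0// P0.
have gPm s : S s -> (gP s <= (m s)%:E)%E.
  move=> Ss; rewrite -mP//; apply: le_esum => r Sr.
  by rewrite lee_fin ler_wpM2r ?P0// lerBlDr lerDl h0.
have gPfin s : S s -> gP s \is a fin_num.
  move=> Ss; rewrite ge0_fin_numE ?gP0//; apply: le_lt_trans (gPm _ Ss) _.
  exact: ltry.
(* From [m = g + h], with [m] invariant and [h] mapped below itself, the image [gP] of [g] is at
   least [g]. *)
have g_le s : S s -> ((g s)%:E <= gP s)%E.
  move=> Ss; have := hP _ Ss.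
  rewrite -(@leeD2lE _ (gP s)) ?gPfin// {1}/gP -esumD; first last.
  - by move=> r Sr; rewrite lee_fin mulr_ge0 ?h0 ?P0.
  - by move=> r Sr; rewrite lee_fin mulr_ge0 ?P0.
  under eq_esum do rewrite -EFinD -mulrDl subrK.
  by rewrite mP// -leeBlDr// -EFinB.
have gsum : (\esum_(s in S) gP s <= \esum_(s in S) (g s)%:E)%E.
  rewrite exchange_esum; last by move=> s r Ss Sr; rewrite lee_fin mulr_ge0 ?P0.
  apply: le_esum => r Sr.
  under eq_esum do rewrite EFinM.
  rewrite esumZl//; last by move=> s Ss; rewrite lee_fin P0.
  by rewrite -[leRHS]mule1 lee_wpmul2l ?P1// lee_fin.
have gfin : (\esum_(s in S) (g s)%:E < +oo)%E.
  apply: le_lt_trans (_ : 1%E < +oo)%E; last exact: ltry.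
  by rewrite -m1; apply: le_esum => r Sr; rewrite lee_fin lerBlDr lerDl h0.
(* [gP] dominates [g] pointwise but has no larger mass, so the two agree. *)
have gE s : S s -> (g s)%:E = gP s.
  move=> Ss; rewrite -(fineK (gPfin _ Ss)); congr (_%:E).
  apply: (@esum_le_eq _ _ S g (fine \o gP)) => //= [r Sr|].
    by rewrite g0/= -lee_fin fineK ?gPfin// g_le.
  rewrite (eq_esum (b := gP))// => r Sr; rewrite fineK//; exact: gPfin.
move=> r Sr; rewrite -g_gt0; move: r Sr.
apply: (irr (A := [set r | 0 < g r])) => [r s Sr Ss /= gr Prs|].
  rewrite -lte_fin gE//.
  have a0 i : S i -> (0 <= (g i * P i s)%:E)%E.
    by move=> Si; rewrite lee_fin mulr_ge0 ?P0.
  apply: lt_le_trans (le_term_esum a0 Sr).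
  by rewrite lte_fin mulr_gt0.
by case: ex => r Sr nm; exists r => //=; rewrite g_gt0.
Qed.

Lemma invariant_unique (m n : T -> R) : invariant_mass m -> invariant_mass n ->
  forall r, S r -> m r = n r.
Proof.
have wlog_le (m' n' : T -> R) : invariant_mass m' -> invariant_mass n' ->
    (forall r, S r -> n' r <= m' r) -> forall r, S r -> n' r = m' r.
  move=> [m0 m1 _] [n0 n1 _] nm; apply: esum_le_eq.
  - by move=> r Sr; rewrite n0 ?nm.
  - by rewrite m1 n1.
  - by rewrite n1 ltry.
move=> Im In; have [ex|nex] := pselect (exists2 r, S r & n r < m r).
  have nm := excess_pos Im In ex.
  by move=> r Sr; rewrite (wlog_le m n)// => s Ss; rewrite ltW ?nm.
apply: (wlog_le n m) => // r Sr; rewrite leNgt; apply/negP => nm.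
by apply: nex; exists r.
Qed.

End Uniqueness.

(** * Products of geometric distributions *)

(** Induction on the number of coordinates: the first one is split off and the double sum
    factors. *)
Lemma esum_ffun_prod (R : realType) (T : choiceType) n (F : 'I_n -> T -> R)
    (c : 'I_n -> R) :
  (forall i k, 0 <= F i k) ->
  (forall i, \esum_(k in [set: T]) (F i k)%:E = (c i)%:E)%E ->
  (\esum_(f in [set: {ffun 'I_n -> T}]) (\prod_i F i (f i))%:E
   = (\prod_i c i)%:E)%E.
Proof.
elim: n F c => [|n IH] F c F0 Fc.
  have T0 (x y : {ffun 'I_0 -> T}) : x = y by apply/ffunP => -[].
  (* The empty function is built from the absurdity of an element of ['I_0], because [T] may be
     empty. *)
  pose f0 : {ffun 'I_0 -> T} := [ffun i : 'I_0 => match i with Ordinal m lt =>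
    False_rect T (notF (etrans (esym (ltn0 m)) lt)) end].
  rewrite [setT](_ : _ = [set f0]); last first.
    by apply/seteqP; split => x _ //=; apply: T0.
  by rewrite esum_set1 !big_ord0.
pose e (p : T * {ffun 'I_n -> T}) : {ffun 'I_n.+1 -> T} :=
  [ffun i => if unlift ord0 i is Some j then p.2 j else p.1].
rewrite (@reindex_esum R _ _
    ([set: T] `*`` (fun=> [set: {ffun 'I_n -> T}])) _ e); last first.
  split=> [//|[k g] [k' g'] _ _ eE|f _].
    have eE' i := congr1 (fun f : {ffun _} => f i) eE.
    congr (_, _); first by have := eE' ord0; rewrite !ffunE unlift_none.
    by apply/ffunP => j; have := eE' (lift ord0 j); rewrite !ffunE liftK.
  exists (f ord0, [ffun j => f (lift ord0 j)]) => //.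
  apply/ffunP => i; rewrite !ffunE.
  by case: unliftP => [j|] -> //=; rewrite ffunE.
pose a k (g : {ffun 'I_n -> T}) := (F ord0 k * \prod_i F (lift ord0 i) (g i))%:E.
rewrite (eq_esum (b := fun p => a p.1 p.2)); last first.
  move=> [k g] _; rewrite /a big_ord_recl ffunE unlift_none; congr (_ * _)%:E.
  by apply: eq_bigr => i _; rewrite ffunE liftK.
have P0 g : 0 <= \prod_i F (lift ord0 i) (g i) by apply: prodr_ge0.
rewrite -(@esum_esum _ _ _ _ _ a); last by move=> k g _ _; rewrite lee_fin mulr_ge0.
have IHc := IH (fun i => F (lift ord0 i)) (fun i => c (lift ord0 i))
  (fun i => F0 (lift ord0 i)) (fun i => Fc (lift ord0 i)).
set C := \prod_i c (lift ord0 i) in IHc *.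
have C0 : 0 <= C by rewrite -lee_fin -IHc esum_ge0// => g _; rewrite lee_fin.
transitivity (\esum_(k in [set: T]) (C%:E * (F ord0 k)%:E))%E.
  apply: eq_esum => k _; rewrite muleC -IHc -esumZl//; last first.
    by move=> g _; rewrite lee_fin.
rewrite esumZl// => [|k _]; last by rewrite lee_fin.
by rewrite Fc -EFinM big_ord_recl mulrC.
Qed.

(** Extending the law by 0 to the integers below 1 lets all sums run over the whole of [int]. *)
Definition geom (R : realType) (p : R) (m : int) : R :=
  if 1 <= m then p * (1 - p) ^+ `|m|.-1 else 0.

Section Geom.
Context (R : realType) (p : R).
Hypothesis p01 : 0 < p < 1.

Lemma geom_ge0 m : 0 <= geom p m.
Proof.
have /andP[p0 p1] := p01; rewrite /geom; case: ifP => // _.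
by rewrite mulr_ge0 ?(ltW p0)// exprn_ge0// subr_ge0 ltW.
Qed.

Lemma esum_geom : (\esum_(m in [set: int]) (geom p m)%:E = 1)%E.
Proof.
have /andP[p0 p1] := p01.
pose e (n : nat) : int := n.+1.
transitivity (\esum_(m in e @` [set: nat]) (geom p m)%:E)%E.
  rewrite [RHS]esum_mkcond; apply: eq_esum => m _.
  case: ifPn => // /negP em; rewrite /geom; case: ifPn => // m1; case: em.
  by rewrite inE; exists `|m|.-1 => //; rewrite /e; lia.
rewrite esum_image; last by move=> x y _ _ []; lia.
rewrite -nneseries_esumT; last by move=> n; rewrite lee_fin geom_ge0.
have p1' : `|1 - p| < 1 by rewrite ger0_norm ?subr_ge0 ?ltW// ltrBlDl ltrDr.
transitivity (\sum_(n <oo) (p * geometric 1 (1 - p) n)%:E)%E.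
  by apply: eq_eseriesr => n _; rewrite /geom/= mul1r.
rewrite eseries_EFinZ; last exact: is_cvg_geometric_series.
rewrite (cvg_lim _ (cvg_geometric_series p1'))//.
by rewrite opprB addrC subrK mul1r divff// gt_eqF.
Qed.

(** The factor on the left matters only at [m = 0], where [geom p 1] would face [geom p 0 = 0]; with
    it the recursion holds on all integers. *)
Lemma geomS m : geom p (m + 1) * (m + 1 != 1)%:R = geom p m * (1 - p).
Proof.
rewrite /geom; case: (ltP 0 m) => m0.
  have -> : 1 <= m by lia.
  have -> : 1 <= m + 1 by lia.
  have -> : m + 1 != 1 by lia.
  have -> : (`|(m + 1)%R|.-1 = `|m|.-1.+1)%N by lia.
  by rewrite exprS mulr1; ring.
have -> : (1 <= m) = false by lia.
rewrite mul0r; case: eqP => [_|?]; first by rewrite mulr0.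
have -> : (1 <= m + 1) = false by lia.
by rewrite mul0r.
Qed.

Lemma geomB m : geom p (m - 1) = geom p m / (1 - p) * (m != 1)%:R.
Proof.
have /andP[p0 p1] := p01.
have z0 : 1 - p != 0 by rewrite gt_eqF// subr_gt0.
have := geomS (m - 1); rewrite subrK => /(canLR (mulfK z0)) <-.
by rewrite mulrAC.
Qed.

End Geom.

(** * Densities, fugacities and the traffic equation *)

Section Rho.
Context (R : realType) (N : nat) (q lambda : R).
Hypothesis q1 : 1 < q.
Local Notation rh := (rho N q lambda).

Lemma rho_gt0 j : 0 < rh j.
Proof.
have z0 : 0 < q `^ (2 * j%:R - N%:R + lambda).
  by rewrite powR_gt0// (lt_trans ltr01).
by rewrite /rho divr_gt0// addr_gt0.
Qed.

Lemma rho_lt1 j : rh j < 1.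
Proof.
have z0 : 0 < q `^ (2 * j%:R - N%:R + lambda).
  by rewrite powR_gt0// (lt_trans ltr01).
by rewrite /rho ltr_pdivrMr ?addr_gt0// mul1r ltrDr.
Qed.

Lemma rho_lt i j : (i < j)%N -> rh i < rh j.
Proof.
move=> ij; rewrite /rho.
have q0 : 0 < q by rewrite (lt_trans ltr01).
set y := q `^ (2 * j%:R - _ + _); set x := q `^ _.
have x0 : 0 < x by rewrite powR_gt0.
have xy : x < y.
  rewrite /x /y /powR gt_eqF// ltr_expR ltr_pM2r ?ln_gt0//.
  by rewrite !ltrD2r ltr_pM2l// ltr_nat.
have y0 : 0 < y := lt_trans x0 xy.
rewrite ltr_pdivrMr ?addr_gt0// mulrAC ltr_pdivlMr ?addr_gt0//.
by rewrite !mulrDr !mulr1 mulrC ltrD2r.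
Qed.

(* The fugacities of the zero-range process; those of the reservoirs [0] and [N]
   are [1] ([fug0], [fugN]). *)
Definition fug (m : nat) : R := 1 - geom_param N q lambda m.

Let den_gt0 m : 0 < rh m * (1 - rh m).
Proof. by rewrite mulr_gt0 ?rho_gt0// subr_gt0 rho_lt1. Qed.

Lemma fug_gt0 m : (m <= N)%N -> 0 < fug m.
Proof.
move=> mN; have d0 := den_gt0 m.
rewrite /fug /geom_param subr_gt0 ltr_pdivrMr// mul1r.
have rmN : rh m <= rh N.
  by move: mN; rewrite leq_eqVlt => /predU1P[->//|/rho_lt/ltW].
have a0 := rho_gt0 0; have am := rho_gt0 m; have N1 := rho_lt1 N.
rewrite -subr_gt0.
(* The numerator of [fug m] is split into a positive and a nonnegative term. *)
have -> : rh m * (1 - rh m) - (rh N - rh m) * (rh m - rh 0) =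
   rh m * (1 - rh N) + rh 0 * (rh N - rh m) by ring.
apply: ltr_wpDr; first by apply: mulr_ge0; rewrite ?subr_ge0 ?(ltW a0).
by apply: mulr_gt0; rewrite ?subr_gt0.
Qed.

Lemma geom_param01 m : (0 < m < N)%N -> 0 < geom_param N q lambda m < 1.
Proof.
move=> /andP[m0 mN]; rewrite -[X in _ && X]subr_gt0 (fug_gt0 (ltnW mN)) andbT.
by rewrite divr_gt0 ?den_gt0// mulr_gt0// subr_gt0 rho_lt.
Qed.

Lemma fug0 : fug 0 = 1.
Proof. by rewrite /fug /geom_param subrr mulr0 mul0r subr0. Qed.

Lemma fugN : fug N = 1.
Proof. by rewrite /fug /geom_param subrr !mul0r subr0. Qed.

Lemma q_sub_inv_gt0 : 0 < q - q^-1.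
Proof.
have q0 : 0 < q by rewrite (lt_trans ltr01).
by rewrite subr_gt0 (lt_trans _ q1)// invf_lt1.
Qed.

Lemma vright_gt0 i : 0 < vright N q lambda i.+1.
Proof.
apply: divr_gt0; first exact: mulr_gt0 q_sub_inv_gt0 (den_gt0 _).
by rewrite subr_gt0 rho_lt.
Qed.

Lemma vleft_gt0 i : 0 < vleft N q lambda i.+1.
Proof.
apply: divr_gt0; first exact: mulr_gt0 q_sub_inv_gt0 (den_gt0 _).
by rewrite subr_gt0 rho_lt.
Qed.

(** By [fE], the product [rh m * (1 - rh m) * fug m] is affine in [rh m] with slope
    [1 - rh N - rh 0]. The left side is [q - q^-1] times its difference quotient between [rh i] and
    [rh i.+1], hence does not depend on [i]. *)
Lemma flux i : vright N q lambda i.+1 * fug i.+1 - vleft N q lambda i.+1 * fug i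
  = (q - q^-1) * (1 - rh N - rh 0).
Proof.
have di := den_gt0 i; have dS := den_gt0 i.+1.
have rS : rh i.+1 - rh i != 0 by rewrite gt_eqF// subr_gt0 rho_lt.
have fE m : rh m * (1 - rh m) * fug m = rh m * (1 - rh N - rh 0) + rh N * rh 0.
  rewrite /fug /geom_param mulrBr mulrCA divff ?gt_eqF ?den_gt0//; ring.
rewrite /vright /vleft /=.
move: (q - q^-1) (fE i.+1) (fE i) => k fS f.
transitivity (k * (rh i.+1 * (1 - rh i.+1) * fug i.+1 -
  rh i * (1 - rh i) * fug i) / (rh i.+1 - rh i)); first by ring.
by rewrite fS f; field.
Qed.

End Rho.

(** * The chain of the distances *)

Section Gates.
Context (N : nat).
Implicit Type r : distances N.

(* Distance number [m], the ordinal [k] with [k.+1 = m], exceeds its minimum.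
   There are no distances number [0] and [N], whose gates are always open: they
   play the role of the reservoirs. *)
Definition gate (m : nat) r : bool :=
  [forall k : 'I_N.-1, (k.+1 == m) ==> (r k != 1)].

(** A unit of distance passes from site [b] to site [a]. The indices 0 and [N] match no [k.+1], so
    exchanges with the reservoirs are transfers too. *)
Definition transfer (a b : nat) r : distances N :=
  [ffun k : 'I_N.-1 => r k + (k.+1 == a)%:Z - (k.+1 == b)%:Z].

Lemma transferK a b : cancel (transfer a b) (transfer b a).
Proof. by move=> r; apply/ffunP => k; rewrite !ffunE; ring. Qed.

Lemma configS r (k : 'I_N.-1) :
  config r (right_end k) = config r (left_end k) + r k.
Proof.
have /ffunP/(_ k) := dist_config r; rewrite ffunE => <-.
by rewrite addrC subrK.
Qed.

(** The ordinal [i] is particle number [i.+1]: the distance on its right has number [i.+1], the one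
    on its left number [i]. *)
Lemma free_right_config r (i : 'I_N) : free_right (config r) i = gate i.+1 r.
Proof.
apply/forallP/forallP => H.
  move=> k; apply/implyP => /eqP [ki].
  have := H (right_end k); rewrite /= ki eqxx /= configS.
  have -> : left_end k = i by apply/val_inj.
  by rewrite (inj_eq (addrI _)).
move=> j; apply/implyP => /eqP ji.
have iN : (i < N.-1)%N by rewrite ltn_predRL -ji.
have := H (Ordinal iN); rewrite eqxx /=.
have -> : j = right_end (Ordinal iN) by apply/val_inj.
rewrite configS; have -> : left_end (Ordinal iN) = i by apply/val_inj.
by rewrite (inj_eq (addrI _)).
Qed.

Lemma free_left_config r (i : 'I_N) : free_left (config r) i = gate i r.
Proof.
have E (k : 'I_N.-1) : right_end k = i ->
    (config r (left_end k) != config r i - 1) = (r k != 1).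
  by move=> <-; rewrite configS; lia.
apply/forallP/forallP => H.
  move=> k; apply/implyP => /eqP ki.
  have rk : right_end k = i by apply/val_inj.
  by have := H (left_end k); rewrite /= ki eqxx /= E.
move=> j; apply/implyP => /eqP ji.
have jN : (j < N.-1)%N by rewrite ltn_predRL ji.
have jE : j = left_end (Ordinal jN) by apply/val_inj.
rewrite jE E; last exact/val_inj.
by have := H (Ordinal jN); rewrite /= ji eqxx.
Qed.

Lemma jump_right r (i : 'I_N) : dist (jump (config r) i 1) = transfer i i.+1 r.
Proof.
apply/ffunP => k; rewrite [LHS]ffunE [jump _ _ _ _]ffunE [X in _ - X]ffunE.
rewrite [RHS]ffunE configS -!(inj_eq val_inj) /= eqSS.
by case: (_ == _); case: (_ == _); lia.
Qed.

Lemma jump_left r (i : 'I_N) : dist (jump (config r) i (-1)) = transfer i.+1 i r.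
Proof.
apply/ffunP => k; rewrite [LHS]ffunE [jump _ _ _ _]ffunE [X in _ - X]ffunE.
rewrite [RHS]ffunE configS -!(inj_eq val_inj) /= eqSS.
by case: (_ == _); case: (_ == _); lia.
Qed.

End Gates.

Section Chain.
Context (R : realType) (N : nat) (w q lambda : R).
Hypotheses (w0 : 0 < w) (q1 : 1 < q).

(** The pair [(i, true)] stands for the right jump of particle number [i.+1], and [(i, false)] for
    its left jump. *)
Definition dist_rate (e : 'I_N * bool) (r : distances N) : R :=
  if e.2 then w * vright N q lambda e.1.+1 * (gate e.1.+1 r)%:R
  else w * vleft N q lambda e.1.+1 * (gate e.1 r)%:R.

Definition dist_step (e : 'I_N * bool) (r : distances N) : distances N :=
  if e.2 then transfer e.1 e.1.+1 r else transfer e.1.+1 e.1 r.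

(** The opposite jump of the same particle. It inverts [dist_step] on all integer vectors, since the
    gates enter only the rates. *)
Definition dist_unstep (e : 'I_N * bool) (r : distances N) : distances N :=
  dist_step (e.1, ~~ e.2) r.

(** The total rate with all gates open, a bound uniform in the state. *)
Definition total_rate : R :=
  \sum_(i < N) (w * vright N q lambda i.+1 + w * vleft N q lambda i.+1).

Lemma dist_genE : @dist_gen R N w q lambda = jump_gen dist_rate dist_step.
Proof.
apply/funext => f; apply/funext => r; rewrite /dist_gen /shock_gen /jump_gen.
rewrite -(pair_bigA _ (fun i b => dist_rate (i, b) r *
  (f (dist_step (i, b) r) - f r))) /=.
apply: eq_bigr => i _; rewrite big_bool /dist_rate /dist_step /=.
by rewrite jump_right jump_left dist_config free_right_config free_left_config.
Qed.

Lemma wvright_gt0 i : 0 < w * vright N q lambda i.+1.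
Proof. by rewrite mulr_gt0// vright_gt0. Qed.

Lemma wvleft_gt0 i : 0 < w * vleft N q lambda i.+1.
Proof. by rewrite mulr_gt0// vleft_gt0. Qed.

Let wvright_ge0 i : 0 <= w * vright N q lambda i.+1.
Proof. exact/ltW/wvright_gt0. Qed.

Let wvleft_ge0 i : 0 <= w * vleft N q lambda i.+1.
Proof. exact/ltW/wvleft_gt0. Qed.

Lemma dist_rate_ge0 e r : 0 <= dist_rate e r.
Proof.
rewrite /dist_rate; case: ifP => _; apply: mulr_ge0; try exact: ler0n.
  exact: wvright_ge0.
exact: wvleft_ge0.
Qed.

Lemma dist_rate_le r : \sum_e dist_rate e r <= total_rate.
Proof.
rewrite -(pair_bigA _ (fun i b => dist_rate (i, b) r)) /=.
apply: ler_sum => i _; rewrite big_bool /dist_rate /=.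
apply: lerD; (apply: ler_piMr; last by rewrite lern1 leq_b1).
  exact: wvright_ge0.
exact: wvleft_ge0.
Qed.

Lemma total_rate_gt0 : (0 < N)%N -> 0 < total_rate.
Proof.
move=> N0; rewrite /total_rate (bigD1 (Ordinal N0))//=.
apply: ltr_wpDr; last exact: addr_gt0 (wvright_gt0 _) (wvleft_gt0 _).
by apply: sumr_ge0 => i _; exact: addr_ge0 (wvright_ge0 _) (wvleft_ge0 _).
Qed.

Lemma dist_stepK e : cancel (dist_step e) (dist_unstep e).
Proof. by case: e => i []; exact: transferK. Qed.

Lemma dist_unstepK e : cancel (dist_unstep e) (dist_step e).
Proof. by case: e => i []; exact: transferK. Qed.

Local Notation gp := (geom_param N q lambda).
Local Notation z := (fug N q lambda).

Definition geom_product (r : distances N) : R :=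
  \prod_(k < N.-1) geom (gp k.+1) (r k).

Let gp01 (k : 'I_N.-1) : 0 < gp k.+1 < 1.
Proof. by apply: geom_param01 => //=; rewrite -ltn_predRL. Qed.

Lemma geom_product_ge0 r : 0 <= geom_product r.
Proof. by apply: prodr_ge0 => k _; apply: geom_ge0. Qed.

Lemma geom_product_out r : ~ dist_states r -> geom_product r = 0.
Proof.
move=> /existsNP [k /negP rk]; rewrite /geom_product (bigD1 k)//= /geom.
by rewrite (negbTE rk) mul0r.
Qed.

(** Written as products over all sites, here and in [gate_prod], the factors of
    [geom_product_transfer] can be compared site by site; for a reservoir every factor is 1. *)
Lemma fug_prod m : (m <= N)%N ->
  z m = \prod_(k < N.-1) (if k.+1 == m then z k.+1 else 1).
Proof.
move=> mN; have [m0N|] := boolP (0 < m < N)%N.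
  have mN' : (m.-1 < N.-1)%N by lia.
  rewrite (bigD1 (Ordinal mN'))//= prednK ?eqxx; last by case/andP: m0N.
  rewrite big1 ?mulr1// => k /eqP km; case: eqP => // kE; case: km.
  by apply/val_inj; rewrite /= -kE.
rewrite negb_and -!leqNgt => mm; rewrite big1 => [|k _]; last first.
  by case: eqP => // km; have := ltn_ord k; lia.
have [->|->] : m = 0%N \/ m = N by lia.
  exact: fug0.
exact: fugN.
Qed.

Lemma gate_prod m r :
  (gate m r)%:R = \prod_(k < N.-1) (if k.+1 == m then (r k != 1)%:R else 1) :> R.
Proof.
have [/forallP g|] := boolP (gate m r).
  rewrite big1// => k _; case: ifP => // km.
  by have := g k; rewrite km /= => ->.
rewrite negb_forall => /existsP[k]; rewrite negb_imply => /andP[km rk].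
by rewrite (bigD1 k)//= km (negbTE rk) mul0r.
Qed.

(* This also holds outside the state space, where [geom] and the gates make
   both sides vanish. *)
Lemma geom_product_transfer a b r : a != b -> (a <= N)%N -> (b <= N)%N ->
  geom_product (transfer a b r) * (gate a (transfer a b r))%:R =
  geom_product r * (z a / z b) * (gate b r)%:R.
Proof.
move=> ab aN bN; rewrite !gate_prod (fug_prod aN) (fug_prod bN) -prodf_div.
rewrite /geom_product -!big_split /=; apply: eq_bigr => k _; rewrite ffunE.
case: (eqVneq k.+1 a) => [ka|_]; case: (eqVneq k.+1 b) => [kb|_] /=.
- by rewrite -ka -kb eqxx in ab.
- by rewrite subr0 divr1 mulr1 geomS// /fug.
- by rewrite addr0 mulr1 geomB// div1r.
- by rewrite addr0 subr0 !mulr1 divr1 mulr1.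
Qed.

Lemma geom_product_balance r :
  \sum_e geom_product (dist_unstep e r) * dist_rate e (dist_unstep e r) =
  geom_product r * \sum_e dist_rate e r.
Proof.
rewrite -(pair_bigA _ (fun i b => geom_product (dist_unstep (i, b) r) *
  dist_rate (i, b) (dist_unstep (i, b) r))).
rewrite -(pair_bigA _ (fun i b => dist_rate (i, b) r)) /= mulr_sumr.
apply/eqP; rewrite -subr_eq0 -sumrB; apply/eqP.
set J := (q - q^-1) * (1 - rho N q lambda N - rho N q lambda 0).
pose h m := (gate m r)%:R / z m : R.
(* The two jumps of one particle are taken together: by [geom_product_transfer] and [flux], their
   inflow minus outflow is a constant multiple of [h i - h i.+1]. *)
transitivity (\sum_(i < N) w * geom_product r * J * (h i - h i.+1)).
  apply: eq_bigr => i _; rewrite !big_bool /dist_unstep /dist_rate /dist_step /=.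
  have iN := ltn_ord i; have iN' := ltnW iN.
  have SR : (i.+1 != i)%N by rewrite neq_ltn ltnSn orbT.
  have SL : (i != i.+1 :> nat)%N by rewrite neq_ltn ltnSn.
  rewrite (mulrCA _ (w * vright _ _ _ _)) (mulrCA _ (w * vleft _ _ _ _)).
  rewrite !geom_product_transfer//.
  have zi : z i != 0 by rewrite gt_eqF// fug_gt0// ltnW.
  have zS : z i.+1 != 0 by rewrite gt_eqF// fug_gt0.
  rewrite /J -(flux N lambda q1 i) /h; move: zi zS.
  move: (z i) (z i.+1) (vright _ _ _ _) (vleft _ _ _ _) (geom_product r).
  by move=> zi zS a b m zi0 zS0; field; rewrite zi0 zS0.
rewrite -mulr_sumr.
have -> : \sum_(i < N) (h i - h i.+1) = h 0%N - h N.
  rewrite -opprB -(telescope_sumr h (leq0n N)) -sumrN big_mkord.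
  by apply: eq_bigr => i _; rewrite opprB.
(* The telescoped sum is 0 because both reservoirs have open gates and fugacity 1, so [h 0] and
   [h N] are both 1. *)
have gate_out m : (forall k : 'I_N.-1, k.+1 != m) -> gate m r.
  by move=> km; apply/forallP => k; rewrite (negbTE (km k)).
rewrite /h fug0 fugN !gate_out ?subrr ?mulr0// => k.
by apply/eqP; have := ltn_ord k; lia.
Qed.

(** * Irreducibility of the chain of the distances *)

Section Access.
Variable A : set (distances N).
Hypothesis Aclosed : forall e r, dist_states r -> A r -> 0 < dist_rate e r ->
  dist_states (dist_step e r) -> A (dist_step e r).

(* Right jumps of the particles [N, N - 1, ..., 1] in turn carry a unit of
   distance through the whole system, so its insertion and its removal at any
   place are both possible. *)
Lemma access_unit r (k : 'I_N.-1) : dist_states r ->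
  A r <-> A [ffun k' => r k' + (k' == k)%:Z].
Proof.
(* [u j] is [r] with an additional unit at distance number [j]; at [j = 0] and [j = N] the unit is
   in a reservoir and [u j] is [r] itself. *)
move=> rS; pose u j : distances N := [ffun k' : 'I_N.-1 => r k' + (k'.+1 == j)%:Z].
have uS j : dist_states (u j) by move=> k'; rewrite ffunE; have /= := rS k'; lia.
have uE j : u j = transfer j j.+1 (u j.+1).
  by apply/ffunP => k'; rewrite !ffunE; ring.
have ug j : gate j.+1 (u j.+1).
  apply/forallP => k'; apply/implyP => /eqP k'j; rewrite ffunE k'j eqxx.
  by have /= := rS k'; lia.
have down j : (j < N)%N -> A (u j.+1) -> A (u j).
  move=> jN Au; have := @Aclosed (Ordinal jN, true) _ (uS j.+1) Au.
  rewrite /dist_step /= -uE; apply => //.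
  by rewrite /dist_rate /= ug mulr1 wvright_gt0.
have downs i j : (i <= j <= N)%N -> A (u j) -> A (u i).
  elim: j => [|j IH] /andP[ij jN]; first by move: ij; rewrite leqn0 => /eqP ->.
  move: ij; rewrite leq_eqVlt => /predU1P[->//|ij Au].
  by apply: IH; [rewrite -ltnS ij ltnW|exact: down].
have u_out m : (forall k' : 'I_N.-1, k'.+1 != m) -> u m = r.
  by move=> km; apply/ffunP => k'; rewrite ffunE (negbTE (km k')) addr0.
have u0 : u 0%N = r by apply: u_out.
have uN : u N = r by apply: u_out => k'; apply/eqP; have := ltn_ord k'; lia.
have -> : [ffun k' => r k' + (k' == k)%:Z] = u k.+1 by [].
have kN : (k.+1 <= N)%N by have := ltn_ord k; lia.
split=> [|Au]; first by rewrite -{1}uN; apply: downs; rewrite kN leqnn.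
by rewrite -u0; apply: downs Au; rewrite kN.
Qed.

(** Units are removed one at a time by [access_unit], by induction on the sum of the distances. As
    each removal is an equivalence, the all-ones state links any two states. *)
Lemma access_ones r : dist_states r -> A r <-> A [ffun=> 1].
Proof.
have [n] := ubnP (\sum_k `|r k|%N); elim: n r => // n IH r rn rS.
have [/forallP r1|] := boolP [forall k, r k == 1].
  by have -> : r = [ffun=> 1] by apply/ffunP => k; rewrite ffunE; apply/eqP.
rewrite negb_forall => /existsP[k rk].
pose r' : distances N := [ffun k' => r k' - (k' == k)%:Z].
have r'S : dist_states r'.
  move=> k'; rewrite ffunE; have /= := rS k'.
  by case: eqP => [->|_]; have /= := rS k; lia.
have -> : r = [ffun k' => r' k' + (k' == k)%:Z].
  by apply/ffunP => k'; rewrite !ffunE subrK.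
rewrite -access_unit//; apply: IH => //.
apply: leq_trans (_ : (\sum_k `|r k|)%N <= n)%N; last by rewrite -ltnS.
rewrite (bigD1 k)//= [leqRHS](bigD1 k)//= -addSn leq_add//.
  by rewrite ffunE eqxx; have /= := rS k; lia.
by apply: leq_sum => k' /negbTE k'k; rewrite ffunE k'k subr0.
Qed.

Lemma access_all : (exists2 r, dist_states r & A r) -> @dist_states N `<=` A.
Proof.
move=> [r rS Ar] s sS.
by apply/access_ones => //; apply/(access_ones rS).
Qed.

End Access.
End Chain.

(** * Invariance, uniqueness and marginals of the product measure *)

Section Main.
Context (R : realType) (N : nat) (w q lambda : R).
Hypotheses (w0 : 0 < w) (q1 : 1 < q) (N0 : (0 < N)%N).

Local Notation mu := (geom_product (N := N) q lambda).
Local Notation gp := (geom_param N q lambda).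
Local Notation Lam := (total_rate N w q lambda).

Let gp01 (k : 'I_N.-1) : 0 < gp k.+1 < 1.
Proof. by apply: geom_param01 => //=; rewrite -ltn_predRL. Qed.

Let rate_ge0 := dist_rate_ge0 (N := N) lambda w0 q1.
Let rate_le := dist_rate_le (N := N) lambda w0 q1.
Let Lam0 := total_rate_gt0 lambda w0 q1 N0.

Lemma dist_transE t r s : dist_trans w q lambda t r s =
  semigroup (jump_gen (dist_rate w q lambda) (@dist_step N)) t (indic_eq R s) r.
Proof. by rewrite /dist_trans dist_genE. Qed.

Lemma geom_product_mass : (\esum_(r in [set: distances N]) (mu r)%:E = 1)%E.
Proof.
rewrite (@esum_ffun_prod R int N.-1 (fun k => geom (gp k.+1)) (fun=> 1)).
- by rewrite big1.
- by move=> k m; apply: geom_ge0.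
- by move=> k; apply: esum_geom.
Qed.

Lemma esum_states (a : distances N -> \bar R) :
  (forall r, ~ dist_states r -> a r = 0%E) ->
  (\esum_(r in @dist_states N) a r = \esum_(r in [set: distances N]) a r)%E.
Proof.
move=> a0; rewrite [LHS]esum_mkcond; apply: eq_esum => r _.
by case: ifPn => // /negP; rewrite inE => /a0.
Qed.

Lemma geom_product_invariant : is_invariant w q lambda mu.
Proof.
split; first split.
- by move=> r; apply: geom_product_ge0.
- by move=> r; apply: geom_product_out.
- rewrite esum_states ?geom_product_mass// => r rS.
  by rewrite geom_product_out.
(* Since the measure vanishes off the state space, the sum may run over all integer vectors, on
   which the steps are bijections. *)
move=> t s t0 sS; rewrite esum_states; last first.
  by move=> r rS; rewrite geom_product_out// mul0r.
under eq_esum do rewrite dist_transE.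
apply: (@trans_stationary _ _ _ _ _ _ Lam0 rate_ge0 rate_le t t0 mu
  (@dist_unstep N)).
- by move=> r; apply: geom_product_ge0.
- exact: dist_stepK.
- exact: dist_unstepK.
- exact: geom_product_balance.
Qed.

Lemma invariant_is_unique (mu1 mu2 : distances N -> R) :
  is_invariant w q lambda mu1 -> is_invariant w q lambda mu2 -> mu1 = mu2.
Proof.
move=> [[p1 out1 m1] inv1] [[p2 out2 m2] inv2]; apply/funext => r.
have [rS|rS] := pselect (dist_states r); last by rewrite out1 ?out2.
(* Time 1 suffices: every jump of positive rate has positive probability at time 1, so a set closed
   under positive transitions is closed under jumps. *)
apply: (@invariant_unique R _ (@dist_states N) (dist_trans w q lambda 1)) => //.
- move=> r' s _ _; rewrite dist_transE.
  apply: (@trans_ge0 _ _ _ _ _ _ Lam0 rate_ge0 rate_le 1 ler01).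
- move=> r' _; under eq_esum do rewrite dist_transE.
  apply: (@trans_substoch _ _ _ _ _ _ Lam0 rate_ge0 rate_le 1 ler01).
- move=> A Acl; apply: (@access_all R N w q lambda w0 q1 A) => e r' r'S Ar' e0 sS.
  apply: (Acl r' _ r'S sS Ar'); rewrite dist_transE.
  apply: (@trans_gt0 _ _ _ _ _ _ Lam0 rate_ge0 rate_le 1 ler01) => //.
- by split=> // s sS; apply: inv1.
- by split=> // s sS; apply: inv2.
Qed.

Lemma marginal_geom_product (i : 'I_N.-1) (k : int) :
  marginal mu i k = geom (gp i.+1) k.
Proof.
(* Coordinate [i] is pinned to the value [k] inside its own factor, so the constrained sum is again
   a sum of products over all vectors; the other factors have mass 1. *)
pose F (j : 'I_N.-1) m := if (j == i) && (m != k) then 0 else geom (gp j.+1) m.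
have F0 j m : 0 <= F j m by rewrite /F; case: ifP => // _; apply: geom_ge0.
pose c (j : 'I_N.-1) := if j == i then geom (gp i.+1) k else 1.
have Fc j : (\esum_(m in [set: int]) (F j m)%:E = (c j)%:E)%E.
  rewrite /F /c; case: eqVneq => [->|_] /=; last exact: esum_geom.
  rewrite (esumID [set k]) => [|m _]; last first.
    by case: ifP => // _; rewrite lee_fin geom_ge0.
  rewrite !setTI esum_set1 eqxx /= ?lee_fin ?geom_ge0// esum1 ?adde0// => m /=.
  by move=> /eqP ->.
rewrite /marginal.
have -> : (\esum_(r in [set r | dist_states r /\ r i = k]) (mu r)%:E =
    \esum_(r in [set: distances N]) (\prod_j F j (r j))%:E)%E.
  rewrite esum_mkcond; apply: eq_esum => r _; case: ifPn => [|/negP].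
    rewrite inE => -[rS rk]; congr (_%:E); apply: eq_bigr => j _.
    by rewrite /F; case: eqVneq => [->|//]; rewrite rk eqxx.
  rewrite inE => rN; rewrite (_ : \prod_j _ = 0)//.
  have [rk|rk] := eqVneq (r i) k; last first.
    by rewrite (bigD1 i)//= /F eqxx rk mul0r.
  have rS : ~ dist_states r by move=> rS; apply: rN.
  rewrite -[RHS](geom_product_out q lambda rS); apply: eq_bigr => j _.
  by rewrite /F; case: eqVneq => [->|//]; rewrite rk eqxx.
rewrite (esum_ffun_prod F0 Fc) /= (bigD1 i)//= /c eqxx big1 ?mulr1//.
by move=> j /negbTE ->.
Qed.

End Main.

Theorem corollary3p13 (R : realType) (N : nat) (w q lambda : R) :
  (2 <= N)%N -> 0 < w -> 1 < q ->
  exists mu : distances N -> R,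
    [/\ is_invariant w q lambda mu,
        forall nu : distances N -> R, is_invariant w q lambda nu -> nu = mu,
        is_product mu
      & forall (i : 'I_N.-1) (k : nat), (1 <= k)%N ->
          let p := geom_param N q lambda i.+1 in
          marginal mu i k%:Z = p * (1 - p) ^+ k.-1].
Proof.
move=> N2 w0 q1; have N0 : (0 < N)%N by apply: ltnW.
have Imu := geom_product_invariant lambda w0 q1 N0.
exists (geom_product q lambda); split=> //.
- by move=> nu Inu; apply: (invariant_is_unique w0 q1 N0 Inu Imu).
- by move=> r _; apply: eq_bigr => i _; rewrite marginal_geom_product.
- move=> i k k1 p; rewrite marginal_geom_product// /geom ifT//; lia.
Qed.
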